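(* Let bounds $S_{\max}\in\mathbb{N}_{\ge 1}\cup\{\infty\}$ and $L_{\max}\in\mathbb{R}_{>0}\cup\{\infty\}$, at least one of them finite, an increasing price function $P:\mathbb{N}_{\ge 1}\to\mathbb{R}_{\ge 0}$ and a price $P_S\in\mathbb{R}_{\ge 0}$ be given such that $P_S<P(k)$ for all sufficiently large $k$. Set $P(0):=0$ and let $K\in\mathbb{N}_{\ge 0}$ be such that $P(K)\le P_S<P(K+1)$. All induced ZSDs (on all PTNs with zone partitions) satisfy the no-stopover property if and only if the following conditions hold: 1. $P(k)\le P(i)+P(k-i+1)$ for all $k\ge 1$ and $i\in\{1,\dots,k\}$; 2. $P(k)\le 2P_S$ for all $k\ge 2K+1$ (with $k\ge 1$); 3. $P(k)\le P(i)+P_S$ for all $k\ge K+1$ and $i\in\{1,\dots,k-K\}$; 4. if $S_{\max}>1$, then $P_S\le P(i)+P(k-i+1)$ for all $k\in\{K+1,\dots,2K-1\}$ and all $i\in\{k-K+1,\dots,K\}$ (this condition is empty for $K\in\{0,1\}$).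
   Context: ''Increasing'' means non-decreasing. A PTN is a finite, simple, connected, undirected graph $(V,E)$ with positive edge lengths. A path is a finite sequence of (not necessarily distinct) nodes with consecutive nodes adjacent; $l(W)$ is the sum of the edge lengths along $W$; $[x_i,x_j]$ denotes the subpath $(x_i,\dots,x_j)$. A zone partition is a partition of $V$ into nonempty zones. The zone border weight of an edge is $b(e)=0$ if its endpoints lie in the same zone and $1$ otherwise; $z(W)=1+\sum_{i=1}^{n-1} b(x_i,x_{i+1})$ for $W=(x_1,\dots,x_n)$. A direct connection between two stations may cross several zones; this is modelled by subdividing it by virtual nodes (which are not actual stations), one for each zone crossed without a station. Hence some nodes of $V$ may be virtual. Virtual nodes are only used to count zones: $s(W)$ is the number of actual stations visited by $W$ (with multiplicity) not counting the start station, i.e. the number of direct connections between consecutive actual stations used by $W$; paths start and end at actual stations, and stopovers are made only at actual stations. A path $W$ is a short-distance path if $s(W)\le S_{\max}$ and $l(W)\le L_{\max}$. The ZSD (combination of a basic zone tariff with a short-distance tariff) induced by $P,P_S,S_{\max},L_{\max}$ on a PTN with zone partition is $$p(W)=\begin{cases}\min\{P_S,P(z(W))\}&\text{if } W \text{ is a short-distance path},\\ P(z(W))&\text{otherwise.}\end{cases}$$ No-stopover property: $p([x_1,x_n])\le p([x_1,x_i])+p([x_i,x_n])$ for all paths $(x_1,\dots,x_n)$, $n\ge 3$, and all intermediate stations $x_i$, $i\in\{2,\dots,n-1\}$. *)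

(* Defs.v *)
From HB Require Import structures.
From mathcomp Require Import all_boot all_order all_algebra.
From mathcomp Require Import constructive_ereal reals.

Set Implicit Arguments.
Unset Strict Implicit.
Unset Printing Implicit Defensive.
Import Order.TTheory GRing.Theory Num.Theory.
Local Open Scope ring_scope.

Definition direct_connection (T : finType) (adj : rel T) (virt : pred T)
    (a : T) (vs : seq T) (b : T) : bool :=
  [&& ~~ virt a, ~~ virt b, all virt vs, uniq (a :: rcons vs b)
    & path adj a (rcons vs b)].

(* Public transportation networks. The last two fields say that virtual nodes
   arise by subdividing direct connections between two actual stations. *)
Record ptn (R : realType) := Ptn {
  node :> finType;
  adj : rel node;
  adj_sym : symmetric adj;
  adj_irrefl : irreflexive adj;
  adj_connected : forall x y, connect adj x y;
  edge_length : node -> node -> R;  (* only meaningful on adjacent nodes *)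
  edge_length_sym : forall x y, edge_length x y = edge_length y x;
  edge_length_gt0 : forall x y, adj x y -> 0 < edge_length x y;
  virtual : pred node;
  virtual_degree : forall v, virtual v -> #|[set w | adj v w]| = 2%N;
  virtual_between : forall v, virtual v ->
    exists a vs b, direct_connection adj virtual a vs b /\ v \in vs
}.

Arguments adj {R p}.
Arguments edge_length {R p}.
Arguments virtual {R p}.

(* A virtual node stands for a zone that a direct connection crosses between
   its neighbouring nodes, hence the second clause. *)
Definition zone_partition (R : realType) (N : ptn R) (Z : {set {set N}}) : Prop :=
  partition Z [set: N] /\
  forall v w : N, virtual v -> adj v w -> pblock Z v != pblock Z w.

Section Paths.
Variables (R : realType) (N : ptn R).
Implicit Type W : seq N.

Definition is_path W : bool :=
  if W is x :: p then [&& path adj x p, ~~ virtual x & ~~ virtual (last x p)]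
  else false.

Definition path_length W : R :=
  if W is x :: p then \sum_(d <- pairmap edge_length x p) d else 0.

Definition station_count W : nat := count (predC virtual) (behead W).

Definition border_weight (Z : {set {set N}}) (x y : N) : nat :=
  if pblock Z x == pblock Z y then 0 else 1.

Definition zone_count (Z : {set {set N}}) W : nat :=
  (1 + (if W is x :: p then sumn (pairmap (border_weight Z) x p) else 0))%N.

(* [Smax = None] encodes an infinite bound. *)
Definition short_distance (Smax : option nat) (Lmax : \bar R) W : bool :=
  (if Smax is Some m then (station_count W <= m)%N else true)
  && ((path_length W)%:E <= Lmax)%E.

Definition zsd (P : nat -> R) (PS : R) (Smax : option nat) (Lmax : \bar R)
    (Z : {set {set N}}) W : R :=
  if short_distance Smax Lmax W then Num.min PS (P (zone_count Z W))
  else P (zone_count Z W).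

(* The path is W1 ++ x :: W2, with a stopover at the intermediate actual
   station x; its two parts are rcons W1 x and x :: W2. *)
Definition no_stopover (price : seq N -> R) : Prop :=
  forall (W1 : seq N) (x : N) (W2 : seq N),
    is_path (W1 ++ x :: W2) -> W1 != [::] -> W2 != [::] -> ~~ virtual x ->
    price (W1 ++ x :: W2) <= price (rcons W1 x) + price (x :: W2).

End Paths.

(* Main.v *)
Require Import Defs.
From HB Require Import structures.
From mathcomp Require Import all_boot all_order all_algebra.
From mathcomp Require Import constructive_ereal reals.
From mathcomp Require Import zify.

Set Implicit Arguments.
Unset Strict Implicit.
Unset Printing Implicit Defensive.
Import Order.TTheory GRing.Theory Num.Theory.
Local Open Scope ring_scope.

(** Sufficiency. A stopover splits a path with z zones into legs with z1 and z2
    zones where z + 1 = z1 + z2, because the zone of the stopover is counted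
    twice ([zone_count_split]). The undivided path never costs more than P z.
    By the choice of K, each leg costs either P of its zone count, or PS while
    it has more than K zones. The four combinations of these cases bound P z by
    conditions 1, 3 (twice) and 2 ([zsd_no_stopover]).

    Necessity. Conditions 1 to 3 are read off from paths on line
    networks: the nodes are 0, ..., n in a row, all edges have the same length,
    zones are the level sets of a function c which grows by at most one along
    each edge, and the nodes of a chosen set are virtual. [line_stopover]
    rephrases the no-stopover property for the path 0, ..., n with stopover t
    in terms of numbers only. If Lmax is finite, the edges get length Lmax / e,
    so that the length bound says that a path has at most e edges. Then
    - [basic_then_basic_leg]: two legs with many stations in one zone, both too
      long to be short-distance paths, give condition 1;
    - [short_then_short_leg]: two short-distance legs, with Smax stations (or
      one, if Smax is infinite) and with one, whose concatenation is not a
      short-distance path, give condition 2;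
    - [basic_then_short_leg]: a leg that is too long followed by a single
      direct connection gives condition 3.
    A single direct connection may cross any number of zones, thanks to virtual
    nodes. Hence a short-distance leg may be given more zones than the
    condition asks for: its price is at most PS anyway, and a larger zone count
    of the whole path only strengthens the bound, as P is increasing. Condition 4
    is a consequence of condition 1, since PS < P k for k > K. *)

(** * Line networks *)

Definition line_adj n (x y : 'I_n.+1) : bool := (x.+1 == y) || (y.+1 == x).

Lemma line_adj_sym n : symmetric (@line_adj n).
Proof. by move=> x y; rewrite /line_adj orbC. Qed.

Lemma line_adj_irrefl n : irreflexive (@line_adj n).
Proof. by move=> x; rewrite /line_adj; lia. Qed.

Lemma line_adj_inord n j : (j < n)%N -> line_adj (inord j) (inord j.+1 : 'I_n.+1).
Proof. by move=> jn; rewrite /line_adj !inordK ?eqxx //; lia. Qed.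

Lemma line_connected n (x y : 'I_n.+1) : connect (@line_adj n) x y.
Proof.
have from0 j : (j <= n)%N -> connect (@line_adj n) ord0 (inord j).
  elim: j => [|j IHj] jn.
    by rewrite (_ : inord 0 = ord0) //; apply/val_inj; rewrite /= inordK.
  exact: connect_trans (IHj (ltnW jn)) (connect1 (line_adj_inord jn)).
have from0' z : connect (@line_adj n) ord0 z.
  by rewrite -(inord_val z) from0 // -ltnS.
have csym : connect_sym (@line_adj n).
  exact: sym_connect_sym (@line_adj_sym n).
by apply: connect_trans (from0' y); rewrite csym.
Qed.

Lemma line_degree n (v : 'I_n.+1) :
  (0 < v < n)%N -> #|[set w | line_adj v w]| = 2%N.
Proof.
move=> vn.
have -> : [set w | line_adj v w] = [set inord v.-1; inord v.+1].
  by apply/setP=> w; rewrite !inE /line_adj -!val_eqE /= !inordK; lia.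
by rewrite cards2 -val_eqE /= !inordK; lia.
Qed.

Definition segment n s d : seq 'I_n.+1 := [seq inord j | j <- iota s d.+1].

Lemma segment_path n s d : (s + d <= n)%N ->
  path (@line_adj n) (inord s) (map inord (iota s.+1 d)).
Proof.
elim: d s => //= d IHd s sd.
by rewrite line_adj_inord ?IHd //; lia.
Qed.

Lemma segment_uniq n s d : (s + d <= n)%N -> uniq (segment n s d).
Proof.
move=> sd; rewrite map_inj_in_uniq ?iota_uniq // => i j.
rewrite !mem_iota => i_in j_in /(congr1 val) /=.
by rewrite !inordK //; lia.
Qed.

(** The direct connection through v runs between the stations nearest to v on
    either side; they exist because both ends of the line are stations. *)
Lemma line_virtual_between n (virt : pred nat) (v : 'I_n.+1) :
  ~~ virt 0%N -> ~~ virt n -> virt v ->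
  exists a vs b, direct_connection (@line_adj n) (fun x => virt x) a vs b
    /\ v \in vs.
Proof.
move=> st0 stn virt_v.
have v_neq j : ~~ virt j -> j != v by apply: contraNneq => ->.
have ex_a : exists j, ~~ virt j && (j < v)%N.
  by exists 0%N; rewrite st0; have := v_neq _ st0; lia.
have ub_a j : ~~ virt j && (j < v)%N -> (j <= v)%N by case/andP=> _ /ltnW.
case: (ex_maxnP ex_a ub_a) => a /andP[st_a av] max_a.
have ex_b : exists j, ~~ virt j && (v < j)%N.
  by exists n; rewrite stn; have := v_neq _ stn; have := ltn_ord v; lia.
case: (ex_minnP ex_b) => b /andP[st_b vb] min_b.
have bn : (b <= n)%N.
  by apply: min_b; rewrite stn; have := v_neq _ stn; have := ltn_ord v; lia.
have inner j : (a < j < b)%N -> virt j.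
  move=> jab; apply: contraT => st_j.
  have [jv|vj|jv] := ltngtP j v.
  - by have := max_a j; rewrite st_j jv /=; lia.
  - by have := min_b j; rewrite st_j vj /=; lia.
  - by move: st_j; rewrite jv virt_v.
exists (inord a), (map inord (iota a.+1 (b - a).-1)), (inord b).
have legE : rcons (map inord (iota a.+1 (b - a).-1)) (inord b : 'I_n.+1)
    = map inord (iota a.+1 (b - a)).
  have -> : (b - a = (b - a).-1 + 1)%N by lia.
  by rewrite iotaD map_cat /= cats1 addn1 /=; congr (rcons _ (inord _)); lia.
split; last first.
  by apply/mapP; exists (v : nat); rewrite ?inord_val // mem_iota; lia.
rewrite /direct_connection legE !inordK ?st_a ?st_b /=; [|lia|lia].
apply/and3P; split; last by apply: segment_path; lia.
- apply/allP=> _ /mapP[j + ->]; rewrite mem_iota => j_in.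
  by rewrite inordK ?inner //; lia.
- by apply: (@segment_uniq n a (b - a)); lia.
Qed.

Definition line_ptn (R : realType) n (virt : pred nat) (l : R) (l_gt0 : 0 < l)
    (st0 : ~~ virt 0%N) (stn : ~~ virt n) : ptn R.
Proof.
refine (@Ptn R 'I_n.+1 (@line_adj n) (@line_adj_sym n) (@line_adj_irrefl n)
  (@line_connected n) (fun _ _ => l) (fun _ _ => erefl) (fun _ _ _ => l_gt0)
  (fun x => virt x) _ (fun v => line_virtual_between st0 stn)).
move=> v virt_v; apply: line_degree.
have v0 : v != 0%N :> nat by apply: contraNneq st0 => <-.
have vn : v != n :> nat by apply: contraNneq stn => <-.
by have := ltn_ord v; lia.
Defined.

Definition level_zones n (c : nat -> nat) : {set {set 'I_n.+1}} :=
  preim_partition (fun x : 'I_n.+1 => c x) [set: 'I_n.+1].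

Lemma level_zonesP n c : partition (level_zones n c) [set: 'I_n.+1].
Proof. exact: preim_partitionP. Qed.

Lemma pblock_level_zones n c (x y : 'I_n.+1) :
  (pblock (level_zones n c) x == pblock (level_zones n c) y) = (c x == c y).
Proof.
have /and3P[/eqP covZ trivZ _] := level_zonesP n c.
rewrite eq_pblock ?covZ ?inE //.
rewrite pblock_equivalence_partition ?inE // => a b d _ _ _ /=.
by split=> // /eqP->.
Qed.

Section Segments.
Variables (R : realType) (n : nat) (virt : pred nat) (l : R).
Hypotheses (l_gt0 : 0 < l) (st0 : ~~ virt 0%N) (stn : ~~ virt n).
Let N := line_ptn l_gt0 st0 stn.

Lemma segment_length s d : path_length (segment n s d : seq N) = d%:R * l.
Proof.
rewrite /path_length /segment /=; move: (inord s : N) => x.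
elim: d s x => [|d IHd] s x /=; first by rewrite big_nil mul0r.
by rewrite big_cons IHd mulrSr mulrDl mul1r addrC.
Qed.

Lemma segment_stations s d : (s + d <= n)%N ->
  station_count (segment n s d : seq N) = count (predC virt) (iota s.+1 d).
Proof.
move=> sd; rewrite /station_count /segment /= count_map.
apply: eq_in_count => j; rewrite mem_iota => j_in /=.
by rewrite inordK //; lia.
Qed.

(** Since c grows by 0 or 1 along each edge, the border weights telescope. *)
Lemma segment_zones c s d :
  (forall j, (c j <= c j.+1 <= (c j).+1)%N) -> (s + d <= n)%N ->
  zone_count (level_zones n c : {set {set N}}) (segment n s d)
    = (1 + (c (s + d) - c s))%N.
Proof.
move=> c_step sd; rewrite /zone_count /segment /=; congr (1 + _)%N.
have c_mono : {homo c : i j / (i <= j)%N}.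
  by apply: homo_leq leq_trans _ => // j; have /andP[] := c_step j.
elim: d s sd => [|d IHd] s sd /=; first by rewrite addn0; lia.
rewrite IHd; last lia.
rewrite /border_weight pblock_level_zones !inordK; [|lia|lia].
have := c_step s; have := c_mono s.+1 (s + d.+1)%N.
by rewrite addnS addSn; case: eqP; lia.
Qed.

Lemma level_zone_partition c :
  (forall j, virt j -> (c j.-1 < c j < c j.+1)%N) ->
  zone_partition (level_zones n c : {set {set N}}).
Proof.
move=> c_virt; split=> [|v w /c_virt cv]; first exact: level_zonesP.
rewrite pblock_level_zones => /orP[] /eqP => [<-|vE]; first lia.
by move: cv; rewrite -vE /=; lia.
Qed.

End Segments.

(** * Prices on line networks *)

(** With edges of length Lmax / e, the length bound becomes a bound by e on the
    number of edges; if Lmax is infinite, any length will do. *)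
Lemma edge_length_cap (R : realType) (Lmax : \bar R) (e : nat) :
  (0 < Lmax)%E -> (0 < e)%N ->
  exists2 l : R, 0 < l &
    forall d, ((d%:R * l)%:E <= Lmax)%E = (Lmax == +oo%E) || (d <= e)%N.
Proof.
case: Lmax => [r||] // r_gt0 e_gt0; last first.
  by exists 1 => // d; rewrite leey eqxx.
have e_gt0' : 0 < e%:R :> R by rewrite ltr0n.
exists (r / e%:R); first by rewrite divr_gt0.
by move=> d; rewrite lee_fin mulrCA ger_pMr // ler_pdivrMr // mul1r ler_nat.
Qed.

Definition line_short (R : realType) (Smax : option nat) (Lmax : \bar R) e
    (stations edges : nat) : bool :=
  (if Smax is Some m then (stations <= m)%N else true)
  && ((Lmax == +oo%E) || (edges <= e)%N).

(** This is the price of the path s, s + 1, ..., s + d on a line whose edges have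
    the length provided by [edge_length_cap]. *)
Definition line_price (R : realType) (Smax : option nat) (Lmax : \bar R)
    (P : nat -> R) (PS : R) e (virt : pred nat) (c : nat -> nat) s d : R :=
  let z := (1 + (c (s + d) - c s))%N in
  if line_short Smax Lmax e (count (predC virt) (iota s.+1 d)) d
  then Num.min PS (P z) else P z.

(** Networks no longer occur in the conclusion, so that exhibiting a path comes
    down to choosing e, n, t, virt and c. The last hypothesis is what makes the
    level sets of c a zone partition at the virtual nodes. *)
Lemma line_stopover (R : realType) (Smax : option nat) (Lmax : \bar R)
    (P : nat -> R) (PS : R) (e n t : nat) (virt : pred nat) (c : nat -> nat) :
  (0 < Lmax)%E ->
  (forall (N : ptn R) (Z : {set {set N}}), zone_partition Z ->
     no_stopover (zsd P PS Smax Lmax Z)) ->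
  (0 < e)%N -> (0 < t < n)%N ->
  ~~ virt 0%N -> ~~ virt t -> ~~ virt n ->
  (forall j, (c j <= c j.+1 <= (c j).+1)%N) ->
  (forall j, virt j -> (c j.-1 < c j < c j.+1)%N) ->
  line_price Smax Lmax P PS e virt c 0 n <=
    line_price Smax Lmax P PS e virt c 0 t
    + line_price Smax Lmax P PS e virt c t (n - t).
Proof.
move=> Lmax_gt0 zsd_ok e_gt0 /andP[t_gt0 tn] st0 st_t stn c_step c_virt.
have [l l_gt0 l_cap] := edge_length_cap Lmax_gt0 e_gt0.
pose N := line_ptn l_gt0 st0 stn.
pose Z : {set {set N}} := level_zones n c.
have priceE s d : (s + d <= n)%N ->
    zsd P PS Smax Lmax Z (segment n s d) = line_price Smax Lmax P PS e virt c s d.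
  move=> sd; rewrite /zsd /short_distance segment_zones //.
  by rewrite segment_stations // segment_length l_cap.
rewrite -!priceE //; try lia.
have wholeE : segment n 0 n =
    map inord (iota 0 t) ++ (inord t : N) :: map inord (iota t.+1 (n - t)).
  rewrite -[RHS]/(_ ++ map inord (iota t (n - t).+1)) -map_cat.
  have -> : iota t (n - t).+1 = iota (0 + t) (n - t).+1 by [].
  by rewrite -iotaD; congr (map _ (iota _ _)); lia.
have headE : segment n 0 t = rcons (map inord (iota 0 t)) (inord t : N).
  by rewrite /segment -[t.+1]addn1 iotaD map_cat cats1.
rewrite wholeE headE.
apply: (zsd_ok N Z (level_zone_partition l_gt0 st0 stn c_virt)).
- rewrite -wholeE; apply/and3P; split.
  + exact: segment_path.
  + by rewrite /virtual /= inordK.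
  + rewrite last_map (last_nth 0%N) size_iota -[0%N :: _]/(iota 0 n.+1).
    by rewrite nth_iota // /virtual /= inordK.
- by rewrite -(prednK t_gt0).
- by rewrite -(@prednK (n - t)) // subn_gt0.
- by rewrite /virtual /= inordK //; lia.
Qed.

(** * Necessity of the conditions *)

Lemma count_stations_all s d : count (predC pred0) (iota s d) = d.
Proof. by rewrite (eq_count (a2 := predT)) ?count_predT ?size_iota. Qed.

Lemma count_stations_leg (virt : pred nat) s d :
  (forall j, (s < j <= s + d)%N -> virt j) -> ~~ virt (s + d.+1)%N ->
  count (predC virt) (iota s.+1 d.+1) = 1%N.
Proof.
move=> inner st_end; rewrite -[d.+1]addn1 iotaD count_cat /= addSnnS st_end.
rewrite (@eq_in_count _ _ pred0) ?count_pred0 // => j.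
by rewrite mem_iota /= => j_in; rewrite inner //; lia.
Qed.

Section Necessity.
Variables (R : realType) (Smax : option nat) (Lmax : \bar R).
Variables (P : nat -> R) (PS : R).
Hypotheses (Smax_ge1 : forall m, Smax = Some m -> (1 <= m)%N)
  (Lmax_gt0 : (0 < Lmax)%E)
  (one_finite : Smax <> None \/ Lmax <> +oo%E)
  (P_incr : forall j k, (1 <= j)%N -> (j <= k)%N -> P j <= P k).
Hypothesis zsd_ok : forall (N : ptn R) (Z : {set {set N}}),
  zone_partition Z -> no_stopover (zsd P PS Smax Lmax Z).

Local Notation short := (line_short Smax Lmax).
(* A station count that short-distance paths may attain; any positive number will do if the
   station bound is infinite. *)
Local Notation m := (odflt 1%N Smax).

(** As one of the bounds is finite, exceeding both station count m and edge count
    e excludes a short-distance path, whichever bound is the finite one. *)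
Lemma line_long e s d : (m < s)%N -> (e < d)%N -> short e s d = false.
Proof.
rewrite /line_short; move=> ms ed; apply/negbTE/negP.
case: Smax one_finite ms => [k|] /= fin ms; first lia.
by case: eqP => [|_ /=]; [case: fin | lia].
Qed.

Lemma line_shortT e s d : (s <= m)%N -> (d <= e)%N -> short e s d.
Proof. by rewrite /line_short => sm ->; rewrite orbT andbT; case: Smax sm. Qed.

Lemma leg_stations_gt0 : (0 < m)%N.
Proof. by case: Smax Smax_ge1 => //= k ->. Qed.

(** The zone of the stopover t contains m + 1 further edges on either side of
    t, which makes both legs too long without adding zones. *)
Lemma basic_then_basic_leg k i : (1 <= i <= k)%N -> P k <= P i + P (k - i + 1)%N.
Proof.
move=> ik; pose t := (i + m)%N; pose n := (t + m + 1 + (k - i))%N.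
pose c j := (minn j (i - 1) + (j - (n - (k - i))))%N.
have := @line_stopover R Smax Lmax P PS 1 n t pred0 c Lmax_gt0 zsd_ok.
have mp := leg_stations_gt0.
rewrite /line_price !count_stations_all !line_long; try lia.
rewrite /c /n /t => H.
have {}H := H isT ltac:(lia) isT isT isT ltac:(lia) ltac:(done).
apply: le_trans (le_trans H _).
  by rewrite le_eqVlt; apply/orP; left; apply/eqP; congr P; lia.
by rewrite le_eqVlt; apply/orP; left; apply/eqP; congr (P _ + P _); lia.
Qed.

(** Stations 0, ..., v share a zone, and two direct connections v -- w and
    w -- n follow. The legs at w have m and 1 stations, and at most w edges, so
    they are short-distance paths, while the whole path exceeds both bounds. *)
Lemma short_then_short_leg k : (1 <= k)%N -> P k <= 2 * PS.
Proof.
move=> k_gt0; pose v := m.-1; pose w := (v + k.+1)%N; pose n := (w + k.+1)%N.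
pose virt j := [&& v < j, j < n & j != w]%N.
pose c j := (j - v)%N; have mp := leg_stations_gt0.
have st_v j : (j <= v)%N -> ~~ virt j by rewrite /virt; lia.
have st_w : ~~ virt w by rewrite /virt eqxx !andbF.
have st_n : ~~ virt n by rewrite /virt ltnn andbF.
have head : count (predC virt) (iota 1 w) = m.
  rewrite iotaD count_cat add1n count_stations_leg //; last first.
    by move=> j; rewrite /virt /n /w; lia.
  rewrite (@eq_in_count _ _ predT) ?count_predT ?size_iota ?/v; first lia.
  by move=> j; rewrite mem_iota /= => j_in; rewrite st_v //; lia.
have tail : count (predC virt) (iota w.+1 k.+1) = 1%N.
  by rewrite count_stations_leg // => j; rewrite /virt /n; lia.
have whole : count (predC virt) (iota 1 n) = m.+1.
  by rewrite iotaD count_cat head add1n tail; lia.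
have := @line_stopover R Smax Lmax P PS w n w virt c Lmax_gt0 zsd_ok.
rewrite /line_price (_ : n - w = k.+1)%N; last by rewrite /n; lia.
rewrite head tail whole line_long ?line_shortT //; try by rewrite /n /w; lia.
have w_gt0 : (0 < w)%N by rewrite /w; lia.
have wn : (w < n)%N by rewrite /n; lia.
have c_step j : (c j <= c j.+1 <= (c j).+1)%N by rewrite /c; lia.
have c_virt j : virt j -> (c j.-1 < c j < c j.+1)%N by rewrite /virt /c; lia.
rewrite w_gt0 wn => /(_ isT isT (st_v _ (leq0n v)) st_w st_n c_step c_virt) H.
rewrite mulr_natl mulr2n; apply: le_trans (le_trans H _).
  by apply: P_incr => //; rewrite /c /n /w; lia.
by apply: lerD; rewrite ge_min lexx.
Qed.

(** The stations 0, ..., t visit i zones and stay in the last one until both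
    bounds are exceeded at t; the direct connection t -- n completes the path. *)
Lemma basic_then_short_leg k i : (1 <= k)%N -> (1 <= i)%N -> P k <= P i + PS.
Proof.
move=> k_gt0 i_gt0; pose t := (i + m + k)%N; pose n := (t + k.+1)%N.
pose virt j := (t < j < n)%N.
pose c j := (minn j (i - 1) + (j - t))%N; have mp := leg_stations_gt0.
have st_t j : (j <= t)%N -> ~~ virt j by rewrite /virt; lia.
have st_n : ~~ virt n by rewrite /virt ltnn andbF.
have head : count (predC virt) (iota 1 t) = t.
  rewrite (@eq_in_count _ _ predT) ?count_predT ?size_iota //.
  by move=> j; rewrite mem_iota /= => j_in; rewrite st_t //; lia.
have tail : count (predC virt) (iota t.+1 k.+1) = 1%N.
  by rewrite count_stations_leg // => j; rewrite /virt /n; lia.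
have whole : count (predC virt) (iota 1 n) = t.+1.
  by rewrite iotaD count_cat head add1n tail; lia.
have := @line_stopover R Smax Lmax P PS k.+1 n t virt c Lmax_gt0 zsd_ok.
rewrite /line_price (_ : n - t = k.+1)%N; last by rewrite /n; lia.
rewrite head tail whole 2?line_long ?line_shortT //; try by rewrite /n /t; lia.
have tn : (0 < t < n)%N by rewrite /n /t; lia.
have c_step j : (c j <= c j.+1 <= (c j).+1)%N by rewrite /c /t; lia.
have c_virt j : virt j -> (c j.-1 < c j < c j.+1)%N by rewrite /virt /c /t; lia.
rewrite tn => /(_ isT isT (st_t _ (leq0n t)) (st_t _ (leqnn t)) st_n c_step c_virt) H.
apply: le_trans (le_trans H _).
  by apply: P_incr => //; rewrite /c /n /t; lia.
rewrite (_ : 1 + (c (0 + t) - c 0) = i)%N; last by rewrite /c /t; lia.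
by rewrite lerD2l ge_min lexx.
Qed.

End Necessity.

(** * Sufficiency of the conditions *)

Lemma zone_count_split (R : realType) (N : ptn R) (Z : {set {set N}})
    (W1 W2 : seq N) (x : N) :
  W1 != [::] ->
  (zone_count Z (W1 ++ x :: W2)).+1 =
    (zone_count Z (rcons W1 x) + zone_count Z (x :: W2))%N.
Proof.
case: W1 => // y p _.
by rewrite /zone_count /= -cat_rcons pairmap_cat sumn_cat last_rcons; lia.
Qed.

(** Each leg is priced at P of its zone count, or at PS with more than K zones,
    and each combination of these cases is covered by one condition. *)
Lemma zsd_no_stopover (R : realType) (Smax : option nat) (Lmax : \bar R)
    (P : nat -> R) (PS : R) (K : nat) (N : ptn R) (Z : {set {set N}}) :
  (forall j k, (1 <= j)%N -> (j <= k)%N -> P j <= P k) ->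
  P K <= PS < P K.+1 ->
  (forall k i, (1 <= k)%N -> (1 <= i <= k)%N ->
     P k <= P i + P (k - i + 1)%N) ->
  (forall k, (1 <= k)%N -> (2 * K + 1 <= k)%N -> P k <= 2 * PS) ->
  (forall k i, (K + 1 <= k)%N -> (1 <= i <= k - K)%N -> P k <= P i + PS) ->
  no_stopover (zsd P PS Smax Lmax Z).
Proof.
move=> P_incr /andP[PK PK1] basic2 short2 basic_short W1 x W2 _ W1n0 _ _.
have zE := zone_count_split Z W2 x W1n0.
have z_gt0 W : (0 < zone_count Z W)%N by [].
set W := W1 ++ x :: W2 in zE *.
apply: (@le_trans _ _ (P (zone_count Z W))).
  by rewrite /zsd; case: ifP => // _; rewrite ge_min lexx orbT.
have partP V : zsd P PS Smax Lmax Z V = P (zone_count Z V)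
    \/ (K < zone_count Z V)%N /\ zsd P PS Smax Lmax Z V = PS.
  rewrite /zsd; case: ifP => _; last by left.
  have [KV|VK] := ltnP K (zone_count Z V).
    by right; split=> //; apply/min_idPl/ltW/(lt_le_trans PK1)/P_incr.
  by left; apply/min_idPr/(le_trans _ PK)/P_incr.
move: (z_gt0 (rcons W1 x)) (z_gt0 (x :: W2)) => z1_gt0 z2_gt0.
case: (partP (rcons W1 x)) => [-> | [K1 ->]];
  case: (partP (x :: W2)) => [-> | [K2 ->]].
- have -> : zone_count Z (x :: W2)
      = (zone_count Z W - zone_count Z (rcons W1 x) + 1)%N by lia.
  by apply: basic2; lia.
- by apply: basic_short; lia.
- by rewrite addrC; apply: basic_short; lia.
- by rewrite -mulr2n -mulr_natl; apply: short2; lia.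
Qed.

Theorem theorem57 (R : realType) (Smax : option nat) (Lmax : \bar R)
    (P : nat -> R) (PS : R) (K : nat)
    (Smax_ge1 : forall m, Smax = Some m -> (1 <= m)%N)
    (Lmax_gt0 : (0 < Lmax)%E)
    (one_finite : Smax <> None \/ Lmax <> +oo%E)
    (P_ge0 : forall k, (1 <= k)%N -> 0 <= P k)
    (P_incr : forall j k, (1 <= j)%N -> (j <= k)%N -> P j <= P k)
    (PS_ge0 : 0 <= PS)
    (PS_lt : exists k0, forall k, (1 <= k)%N -> (k0 <= k)%N -> PS < P k)
    (P0 : P 0%N = 0)
    (PK : P K <= PS < P K.+1) :
  (forall (N : ptn R) (Z : {set {set N}}), zone_partition Z ->
     no_stopover (zsd P PS Smax Lmax Z))
  <->
  [/\ forall k i, (1 <= k)%N -> (1 <= i <= k)%N ->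
        P k <= P i + P (k - i + 1)%N,
      forall k, (1 <= k)%N -> (2 * K + 1 <= k)%N -> P k <= 2 * PS,
      forall k i, (K + 1 <= k)%N -> (1 <= i <= k - K)%N -> P k <= P i + PS
    & (forall m, Smax = Some m -> (1 < m)%N) ->
        forall k i, (K + 1 <= k <= 2 * K - 1)%N -> (k - K + 1 <= i <= K)%N ->
          PS <= P i + P (k - i + 1)%N].
Proof.
split=> [zsd_ok | [basic2 short2 basic_short _] N Z _]; last first.
  exact: zsd_no_stopover P_incr PK basic2 short2 basic_short.
have basic2 := basic_then_basic_leg Smax_ge1 Lmax_gt0 one_finite zsd_ok.
split=> [k i _|k k_gt0 _|k i Kk ik|_ k i kK ik].
- exact: basic2.
- exact: (short_then_short_leg Smax_ge1 Lmax_gt0 one_finite P_incr zsd_ok).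
- by apply: (basic_then_short_leg Smax_ge1 Lmax_gt0 one_finite P_incr zsd_ok); lia.
- apply: le_trans (basic2 k i _); last lia.
  by case/andP: PK => _ /ltW/le_trans; apply; apply: P_incr; lia.
Qed.
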